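(* Let $\mathbf{V}$ be a nontrivial locally finite variety of lattices (lattices being regarded as algebras with two binary operations $\land,\lor$) which is distinct from the variety $\mathbf{L}$ of all lattices and from the variety $\mathbf{D}$ of all distributive lattices. Let $\mathbf{V}^{\mathit{fin}}$ be the class of all finite lattices in $\mathbf{V}$. Then no reasonable (JEP)-expansion of $\mathbf{V}^{\mathit{fin}}$ has the Ramsey property.
   Context: A lattice is an algebra $(L,\land,\lor)$ with both operations idempotent, commutative and associative, satisfying the absorption laws. A variety is a class of algebras over a fixed algebraic language closed under homomorphic images, subalgebras and arbitrary products. A variety of lattices is nontrivial if it contains a lattice with more than one element, and locally finite if every finitely generated member is finite. Structures. For a first-order language $\Theta$ (relation symbols of positive arity; function symbols of any arity, including constants), an embedding $f:\mathcal{A}\hookrightarrow\mathcal{B}$ of $\Theta$-structures is an injective map that preserves and reflects all relations and commutes with all functions. $\mathcal{A}\le\mathcal{B}$ means $\mathcal{A}$ is a substructure of $\mathcal{B}$. Order expansions. Let $<\,\notin\Theta$ be a new binary relation symbol and $\Theta^*=\Theta\cup\{<\}$; in every $\Theta^*$-structure considered, $<$ is interpreted as a (strict) linear order on the underlying set. A class $\mathbf{K}^*$ of $\Theta^*$-structures is an order expansion of a class $\mathbf{K}$ of $\Theta$-structures if $\mathcal{A}\in\mathbf{K}$ for every $(\mathcal{A},<)\in\mathbf{K}^*$, and for every $\mathcal{A}\in\mathbf{K}$ there is at least one linear order $<$ on $A$ with $(\mathcal{A},<)\in\mathbf{K}^*$. It is reasonable if for all $\mathcal{A},\mathcal{B}\in\mathbf{K}$,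 every embedding $f:\mathcal{A}\hookrightarrow\mathcal{B}$ and every linear order $<$ on $A$ with $(\mathcal{A},<)\in\mathbf{K}^*$, there is a linear order $\sqsubset$ on $B$ such that $(\mathcal{B},\sqsubset)\in\mathbf{K}^*$ and $f$ is an embedding of $(\mathcal{A},<)$ into $(\mathcal{B},\sqsubset)$. A class has the joint embedding property (JEP) if any two of its members embed into a common member. A reasonable (JEP)-expansion of $\mathbf{K}$ is a reasonable order expansion of $\mathbf{K}$ having (JEP). Here $\Theta=\{\land,\lor\}$ and $\mathbf{K}=\mathbf{V}^{\mathit{fin}}$. Ramsey property. For finite structures, $\binom{\mathcal{B}}{\mathcal{A}}=\{\tilde{\mathcal{A}}:\tilde{\mathcal{A}}\le\mathcal{B},\ \tilde{\mathcal{A}}\cong\mathcal{A}\}$. Write $\mathcal{C}\longrightarrow(\mathcal{B})^{\mathcal{A}}_k$ if for every partition $\binom{\mathcal{C}}{\mathcal{A}}=\mathcal{X}_1\cup\dots\cup\mathcal{X}_k$ there are $\tilde{\mathcal{B}}\in\binom{\mathcal{C}}{\mathcal{B}}$ and $j$ with $\binom{\tilde{\mathcal{B}}}{\mathcal{A}}\subseteq\mathcal{X}_j$. A class $\mathbf{K}$ of finite structures has the Ramsey property if for all $\mathcal{A},\mathcal{B}\in\mathbf{K}$ with $\mathcal{A}\hookrightarrow\mathcal{B}$ and every integer $k\ge2$ there is $\mathcal{C}\in\mathbf{K}$ with $\mathcal{C}\longrightarrow(\mathcal{B})^{\mathcal{A}}_k$. *)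

(* Defs.v *)
From mathcomp Require Import all_boot.
From mathcomp Require Import boolp classical_sets cardinality.

Set Implicit Arguments.
Unset Strict Implicit.
Unset Printing Implicit Defensive.

Local Open Scope classical_set_scope.

(* Lattices as nonempty algebras with two binary operations.  [latticeType] is
   not used: it bundles an order, a choice structure and a display, whereas
   varieties are closed under arbitrary products and homomorphic images of the
   bare algebras. *)
Record lattice := Lattice {
  carrier :> Type;
  meet : carrier -> carrier -> carrier;
  join : carrier -> carrier -> carrier;
  lattice_inhabited : inhabited carrier;
  meet_idem : idempotent_op meet;
  join_idem : idempotent_op join;
  meet_comm : commutative meet;
  join_comm : commutative join;
  meet_assoc : associative meet;
  join_assoc : associative join;
  meet_joinK : forall x y, meet x (join x y) = x;
  join_meetK : forall x y, join x (meet x y) = x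
}.

Definition lattice_hom (L M : lattice) (f : L -> M) : Prop :=
  {morph f : x y / meet x y >-> meet x y} /\
  {morph f : x y / join x y >-> join x y}.

Definition lattice_embedding (L M : lattice) (f : L -> M) : Prop :=
  injective f /\ lattice_hom f.

Definition sub_universe (L : lattice) (S : set L) : Prop :=
  [/\ S !=set0,
      forall x y, S x -> S y -> S (meet x y) &
      forall x y, S x -> S y -> S (join x y)].

Section Sublattice.
Variables (L : lattice) (S : set L) (subS : sub_universe S).

Definition sub_meet (x y : {x | S x}) : {x | S x} :=
  exist S (meet (sval x) (sval y))
    (let: And3 _ SI _ := subS in SI _ _ (svalP x) (svalP y)).

Definition sub_join (x y : {x | S x}) : {x | S x} :=
  exist S (join (sval x) (sval y))
    (let: And3 _ _ SU := subS in SU _ _ (svalP x) (svalP y)).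

Lemma sub_sval_inj (x y : {x | S x}) : sval x = sval y -> x = y.
Proof. by case: x y => [x Sx] [y Sy] /= exy; apply: eq_exist. Qed.

Lemma sub_inhabited : inhabited {x | S x}.
Proof. by case: subS => -[x Sx] _ _; exists; exists x. Qed.

Definition sublattice : lattice.
Proof.
apply: (@Lattice {x | S x} sub_meet sub_join sub_inhabited).
- by move=> x; apply: sub_sval_inj; apply: meet_idem.
- by move=> x; apply: sub_sval_inj; apply: join_idem.
- by move=> x y; apply: sub_sval_inj; apply: meet_comm.
- by move=> x y; apply: sub_sval_inj; apply: join_comm.
- by move=> x y z; apply: sub_sval_inj; apply: meet_assoc.
- by move=> x y z; apply: sub_sval_inj; apply: join_assoc.
- by move=> x y; apply: sub_sval_inj; apply: meet_joinK.
- by move=> x y; apply: sub_sval_inj; apply: join_meetK.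
Defined.
End Sublattice.

Section Product.
Variables (I : Type) (F : I -> lattice).

Definition prod_meet (x y : forall i, F i) i : F i := meet (x i) (y i).
Definition prod_join (x y : forall i, F i) i : F i := join (x i) (y i).

Lemma prod_inhabited : inhabited (forall i, F i).
Proof.
apply: inhabits => i.
have ex : exists _ : F i, True by case: (lattice_inhabited (F i)) => x; exists x.
by case: (cid ex).
Qed.

Definition prod_lattice : lattice.
Proof.
apply: (@Lattice (forall i, F i) prod_meet prod_join prod_inhabited).
- by move=> x; apply: functional_extensionality_dep => i; apply: meet_idem.
- by move=> x; apply: functional_extensionality_dep => i; apply: join_idem.
- by move=> x y; apply: functional_extensionality_dep => i; apply: meet_comm.
- by move=> x y; apply: functional_extensionality_dep => i; apply: join_comm.
- by move=> x y z; apply: functional_extensionality_dep => i; apply: meet_assoc.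
- by move=> x y z; apply: functional_extensionality_dep => i; apply: join_assoc.
- by move=> x y; apply: functional_extensionality_dep => i; apply: meet_joinK.
- by move=> x y; apply: functional_extensionality_dep => i; apply: join_meetK.
Defined.
End Product.

Record variety (V : lattice -> Prop) : Prop := Variety {
  variety_image : forall (L M : lattice) (f : L -> M),
    V L -> lattice_hom f -> (forall y, exists x, f x = y) -> V M;
  variety_sub : forall (L : lattice) (S : set L) (subS : sub_universe S),
    V L -> V (sublattice subS);
  variety_prod : forall (I : Type) (F : I -> lattice),
    (forall i, V (F i)) -> V (prod_lattice F)
}.

Definition nontrivial (V : lattice -> Prop) : Prop :=
  exists2 L, V L & exists x y : L, x <> y.

Definition finitely_generated (L : lattice) : Prop :=
  exists2 G : set L, finite_set G &
    forall S : set L, sub_universe S -> G `<=` S -> S = [set: L].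

Definition finite_lattice (L : lattice) : Prop := finite_set [set: L].

Definition locally_finite (V : lattice -> Prop) : Prop :=
  forall L, V L -> finitely_generated L -> finite_lattice L.

Definition distributive_lattice (L : lattice) : Prop :=
  right_distributive (@meet L) (@join L).

Definition fin_members (V : lattice -> Prop) (L : lattice) : Prop :=
  V L /\ finite_lattice L.

Definition strict_linear_order (T : Type) (r : rel T) : Prop :=
  [/\ irreflexive r, transitive r & forall x y, x <> y -> r x y || r y x].

(* The order [olt] is unrelated to the lattice order. *)
Record ordered_lattice := OrderedLattice {
  reduct :> lattice;
  olt : rel reduct;
  olt_linear : strict_linear_order olt
}.

Definition ordered_embedding (A B : ordered_lattice) (f : A -> B) : Prop :=
  lattice_embedding f /\ {mono f : x y / olt x y >-> olt x y}.

Definition embeds (A B : ordered_lattice) : Prop :=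
  exists f : A -> B, ordered_embedding f.

Definition isomorphic (A B : ordered_lattice) : Prop :=
  exists2 f : A -> B, ordered_embedding f & bijective f.

Section Substructure.
Variables (A : ordered_lattice) (S : set A) (subS : sub_universe S).

Definition sub_olt : rel (sublattice subS) := fun x y => olt (sval x) (sval y).

Lemma sub_olt_linear : strict_linear_order sub_olt.
Proof.
case: (olt_linear A) => irr tr tot; split.
- by move=> x; apply: irr.
- by move=> y x z; apply: tr.
- by move=> x y nxy; apply: tot => /sub_sval_inj.
Qed.

Definition substructure : ordered_lattice := OrderedLattice sub_olt_linear.
End Substructure.

Definition order_expansion (K : lattice -> Prop) (Ks : ordered_lattice -> Prop)
    : Prop :=
  (forall A : ordered_lattice, Ks A -> K A) /\
  (forall A : lattice, K A ->
     exists (r : rel A) (hr : strict_linear_order r), Ks (OrderedLattice hr)).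

Definition reasonable (K : lattice -> Prop) (Ks : ordered_lattice -> Prop)
    : Prop :=
  forall (A B : lattice) (f : A -> B), K A -> K B -> lattice_embedding f ->
  forall (r : rel A) (hr : strict_linear_order r), Ks (OrderedLattice hr) ->
  exists (s : rel B) (hs : strict_linear_order s),
    Ks (OrderedLattice hs) /\
    @ordered_embedding (OrderedLattice hr) (OrderedLattice hs) f.

Definition joint_embedding (Ks : ordered_lattice -> Prop) : Prop :=
  forall A B, Ks A -> Ks B -> exists2 C, Ks C & embeds A C /\ embeds B C.

Definition reasonable_JEP_expansion
    (K : lattice -> Prop) (Ks : ordered_lattice -> Prop) : Prop :=
  [/\ order_expansion K Ks, reasonable K Ks & joint_embedding Ks].

(* Substructures are identified with their underlying sets. *)
Definition copies (B A : ordered_lattice) : set (set B) :=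
  [set S | exists subS : sub_universe S, isomorphic (substructure subS) A].
Arguments copies : clear implicits.

(* Blocks of a partition are allowed to be empty.  The copies of [A] in a
   substructure [S] of [C] are the copies of [A] in [C] contained in [S]. *)
Definition arrow (C B A : ordered_lattice) (k : nat) : Prop :=
  forall X : 'I_k -> set (set C),
    trivIset [set: 'I_k] X -> \bigcup_j X j = copies C A ->
  exists2 S, copies C B S &
    exists j, forall T, copies C A T -> T `<=` S -> X j T.

Definition Ramsey (Ks : ordered_lattice -> Prop) : Prop :=
  forall A B, Ks A -> Ks B -> embeds A B ->
  forall k, 2 <= k -> exists2 C, Ks C & arrow C B A k.

(* Main.v *)
Require Import Defs.
From mathcomp Require Import all_boot all_order.
From mathcomp Require Import boolp classical_sets cardinality.
Import Order.TTheory.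

(** The Ramsey property and joint embedding give amalgamation: given A inside
    B1 and B2, embed both in a common E and colour a copy of A in C according
    to whether it extends to a copy of B1 in a prescribed way.  In a
    monochromatic copy of E the copy of A coming from B1 extends, hence so does
    the copy coming from B2; since a finite linearly ordered structure is
    rigid, the two copies of A then agree pointwise and C is an amalgam
    ([Ramsey_amalgamation]).  A reasonable expansion lets one forget the orders,
    so the finite members of V have the amalgamation property
    ([Ramsey_expansion_amalgamation]).

    It remains to see that a nontrivial locally finite variety whose finite
    members amalgamate is the variety of distributive lattices.  Only amalgams
    over a three-element chain are needed.

    Suppose first that V has a nonmodular member, hence a finite one containing
    a pentagon: a < c < t, and b with b v a = t, b ^ c < a.  For p, q, m in a
    lattice put e_0 = p, e_1 = q, e_(i+2) = e_i v (e_(i+1) ^ m) and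
    v_i = e_i ^ m.  If v_0 < v_1 < ... < v_(n+1) in a finite C, amalgamate C
    with the pentagon along v_0 = a, v_1 = c, e_1 = t.  Then b v v_0 = e_1, so
    starting with (b, p) in place of (p, q) puts b in front of the sequence e,
    and the new trace b ^ m = b ^ c lies strictly below v_0.  Thus the number of
    distinct traces, all generated by p, q, m, is unbounded
    ([long_zigzag]), which contradicts local finiteness in the product of these
    examples ([amalgamation_modular]).

    So every member of V is modular.  If one is not distributive, V has a finite
    member B containing a diamond s < a, b, c < t.  In B x B there is a diamond
    with bottom (s, s), first atom (a, s) and top (t, s), which is
    strictly below (t, t).  Amalgamate B and (a finite sublattice of) B x B by
    identifying the chains s < a < t and (s, s) < (a, s) < (t, t).  By modularity
    a diamond makes the interval above an atom isomorphic to the one below it,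
    so in the amalgam the finite interval [a, t] injects into its proper
    subset [a, (t, s)], which is absurd ([diamond_top_unique],
    [amalgamation_distributive]).

    Conversely, a nontrivial variety contains all distributive lattices because
    these embed in powers of any nontrivial lattice, by prime ideals
    ([distributive_in_variety]). *)

Set Implicit Arguments.
Unset Strict Implicit.
Unset Printing Implicit Defensive.

Local Open Scope classical_set_scope.

Local Notation "x ⊓ y" := (meet x y) (at level 40, left associativity).
Local Notation "x ⊔ y" := (join x y) (at level 50, left associativity).

(** * Order and modularity in a lattice *)

Definition lat_le (L : lattice) (x y : L) : Prop := x ⊓ y = x.
Local Notation "x ⊑ y" := (lat_le x y) (at level 70).

Definition lat_lt (L : lattice) (x y : L) : Prop := x ⊑ y /\ x <> y.
Local Notation "x ⊏ y" := (lat_lt x y) (at level 70).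

Definition dual_lattice (L : lattice) : lattice :=
  Lattice (lattice_inhabited L) (@join_idem L) (@meet_idem L) (@join_comm L)
    (@meet_comm L) (@join_assoc L) (@meet_assoc L) (@join_meetK L)
    (@meet_joinK L).

Section LatticeTheory.
Variable L : lattice.
Implicit Types x y z w a b s t : L.

Lemma le_joinE x y : x ⊑ y <-> x ⊔ y = y.
Proof.
split; rewrite /lat_le => e.
  by rewrite -e join_comm meet_comm join_meetK.
by rewrite -e meet_joinK.
Qed.

Lemma le_dualE x y : @lat_le (dual_lattice L) x y <-> y ⊑ x.
Proof. by rewrite le_joinE /lat_le /= join_comm. Qed.

Lemma latxx x : x ⊑ x.
Proof. exact: meet_idem. Qed.

Lemma lat_trans y x z : x ⊑ y -> y ⊑ z -> x ⊑ z.
Proof. by rewrite /lat_le => xy yz; rewrite -xy -meet_assoc yz. Qed.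

Lemma lat_anti x y : x ⊑ y -> y ⊑ x -> x = y.
Proof. by rewrite /lat_le => xy yx; rewrite -xy meet_comm. Qed.

Lemma latIl x y : x ⊓ y ⊑ x.
Proof. by rewrite /lat_le meet_comm meet_assoc meet_idem. Qed.

Lemma latIr x y : x ⊓ y ⊑ y.
Proof. by rewrite meet_comm; apply: latIl. Qed.

Lemma latUl x y : x ⊑ x ⊔ y.
Proof. exact: meet_joinK. Qed.

Lemma latUr x y : y ⊑ x ⊔ y.
Proof. by rewrite join_comm; apply: latUl. Qed.

Lemma latxI x y z : x ⊑ y -> x ⊑ z -> x ⊑ y ⊓ z.
Proof. by rewrite /lat_le => xy xz; rewrite meet_assoc xy. Qed.

Lemma latUx x y z : x ⊑ z -> y ⊑ z -> x ⊔ y ⊑ z.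
Proof. by move=> /le_joinE xz /le_joinE yz; apply/le_joinE; rewrite -join_assoc yz. Qed.

Lemma latI2 x y z w : x ⊑ z -> y ⊑ w -> x ⊓ y ⊑ z ⊓ w.
Proof.
by move=> xz yw; apply: latxI; [apply: lat_trans xz|apply: lat_trans yw];
  [apply: latIl|apply: latIr].
Qed.

Lemma latU2 x y z w : x ⊑ z -> y ⊑ w -> x ⊔ y ⊑ z ⊔ w.
Proof.
by move=> xz yw; apply: latUx; [apply: lat_trans xz _|apply: lat_trans yw _];
  [apply: latUl|apply: latUr].
Qed.

Lemma meet_l x y : x ⊑ y -> x ⊓ y = x. Proof. by []. Qed.

Lemma meet_r x y : x ⊑ y -> y ⊓ x = x. Proof. by rewrite meet_comm. Qed.

Lemma join_r x y : x ⊑ y -> x ⊔ y = y. Proof. by move/le_joinE. Qed.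

Lemma join_l x y : x ⊑ y -> y ⊔ x = y.
Proof. by rewrite join_comm; apply: join_r. Qed.

Lemma lat_lt_trans y x z : x ⊏ y -> y ⊏ z -> x ⊏ z.
Proof.
move=> [xy nxy] [yz nyz]; split; first exact: lat_trans yz.
by move=> exz; apply: nxy; apply: lat_anti => //; rewrite exz.
Qed.

End LatticeTheory.

Definition modular (L : lattice) : Prop :=
  forall x y z : L, x ⊑ z -> x ⊔ (y ⊓ z) = (x ⊔ y) ⊓ z.

Lemma modular_dual (L : lattice) : modular L -> modular (dual_lattice L).
Proof.
have flip (x y z : L) : modular L -> z ⊑ x -> x ⊓ (y ⊔ z) = (x ⊓ y) ⊔ z.
  move=> modL zx.
  by rewrite join_comm meet_comm -modL// join_comm [y ⊓ x]meet_comm.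
by move=> modL x y z /le_dualE; apply: flip.
Qed.

(** A failure of the modular law produces a pentagon with top t; its bottom is
    b ⊓ c.  Only the relations that drive the zigzag construction are kept. *)
Lemma not_modularP (L : lattice) : ~ modular L ->
  exists a c b t : L, [/\ a ⊏ c, c ⊏ t, b ⊔ a = t & b ⊓ c ⊏ a].
Proof.
move=> nmod; apply: contrapT => nex; apply: nmod => x y z xz.
apply: contrapT => ne.
have le1 : x ⊔ (y ⊓ z) ⊑ (x ⊔ y) ⊓ z.
  apply: latUx; first by apply: latxI => //; apply: latUl.
  by apply: latI2; [apply: latUr|apply: latxx].
have yc : y ⊓ ((x ⊔ y) ⊓ z) = y ⊓ z.
  by rewrite meet_assoc [y ⊓ _]meet_l//; apply: latUr.
apply: nex; exists (x ⊔ (y ⊓ z)), ((x ⊔ y) ⊓ z), y, (x ⊔ y).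
split; [by []| | |].
- split; first exact: latIl.
  move=> e; apply: ne; apply: lat_anti => //; rewrite e.
  apply: latUx; first exact: latUl.
  apply: lat_trans (latUr _ _); apply: latxI; first exact: latxx.
  by apply: lat_trans (latUr x y) _; rewrite -e; apply: latIr.
- rewrite join_comm -join_assoc [_ ⊔ y]join_comm join_meetK //.
- rewrite yc; split; first exact: latUr.
  move=> e; apply: ne; apply: lat_anti => //.
  have xy : x ⊑ y.
    by apply: lat_trans (latIl y z); rewrite e; apply: latUl.
  by rewrite (join_r xy) -e; apply: latxx.
Qed.

(** * Diamonds *)

Definition diamond (L : lattice) (s a b c t : L) : Prop :=
  [/\ a ⊓ b = s, a ⊓ c = s & b ⊓ c = s] /\ [/\ a ⊔ b = t, a ⊔ c = t & b ⊔ c = t].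

(** The classical candidates for a diamond in a modular lattice: the projections
    of x, y, z into the interval between the two medians of x, y, z. *)
Definition median_proj (L : lattice) (x y z : L) : L :=
  (x ⊓ (y ⊔ z)) ⊔ (y ⊓ z).

Definition lower_median (L : lattice) (x y z : L) : L :=
  (x ⊓ y) ⊔ (x ⊓ z) ⊔ (y ⊓ z).

Section Diamond.
Variables (L : lattice) (modL : modular L).
Implicit Types x y z : L.

Lemma median_projC x y z : median_proj x z y = median_proj x y z.
Proof. by rewrite /median_proj [z ⊔ y]join_comm [z ⊓ y]meet_comm. Qed.

(** The projection is self-dual by modularity, so that the computation of meets
    below also yields the joins. *)
Lemma median_proj_dual x y z :
  @median_proj (dual_lattice L) x y z = median_proj x y z.
Proof.
rewrite /median_proj /= [x ⊔ _]join_comm -modL; first exact: join_comm.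
by apply: lat_trans (latIl _ _) (latUl _ _).
Qed.

Lemma median_proj_meet x y z :
  median_proj x y z ⊓ median_proj y x z = lower_median x y z.
Proof.
have q_ge : y ⊓ z ⊑ median_proj y x z.
  apply: lat_trans (latUl _ _); apply: latI2; first exact: latxx.
  exact: latUr.
rewrite [median_proj x y z]join_comm -modL// -[median_proj y x z]median_proj_dual.
rewrite /lower_median [RHS]join_comm; congr join.
rewrite [X in _ = X ⊔ _]meet_comm [RHS]join_comm modL; last exact: latIl.
rewrite /median_proj /= [RHS]meet_comm; apply: lat_anti.
  rewrite [X in _ ⊑ x ⊓ X]join_comm.
  by apply: latI2; [apply: latIl|apply: latIl].
apply: latxI.
  apply: latI2; first exact: latxx.
  by rewrite join_comm; apply: latU2; [apply: latxx|apply: latIr].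
apply: latxI; first by rewrite join_comm; apply: latIr.
by apply: lat_trans (latIl _ _) (latUl _ _).
Qed.

Lemma lower_medianC x y z : lower_median y x z = lower_median x y z.
Proof. by rewrite /lower_median [y ⊓ x]meet_comm -!join_assoc [X in _ ⊔ X]join_comm. Qed.

Lemma lower_medianAC x y z : lower_median x z y = lower_median x y z.
Proof. by rewrite /lower_median [z ⊓ y]meet_comm [X in X ⊔ _ = _]join_comm. Qed.

End Diamond.

Lemma median_diamond (L : lattice) (x y z : L) : modular L ->
  diamond (lower_median x y z)
    (median_proj x y z) (median_proj y x z) (median_proj z x y)
    (@lower_median (dual_lattice L) x y z).
Proof.
have meets (M : lattice) (u v w : M) : modular M ->
    [/\ median_proj u v w ⊓ median_proj v u w = lower_median u v w,
        median_proj u v w ⊓ median_proj w u v = lower_median u v w &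
        median_proj v u w ⊓ median_proj w u v = lower_median u v w].
  move=> modM; split.
  - exact: median_proj_meet.
  - by rewrite -[median_proj u v w]median_projC median_proj_meet// lower_medianAC.
  - rewrite -[median_proj v u w]median_projC -[median_proj w u v]median_projC.
    by rewrite median_proj_meet// lower_medianAC lower_medianC.
move=> modL; split; first exact: meets.
have := meets (dual_lattice L) x y z (modular_dual modL).
by rewrite !(median_proj_dual modL).
Qed.

(** If the two medians coincide, meeting both with x gives the distributive law
    for x, y, z. *)
Lemma not_distributive_diamond (L : lattice) :
    modular L -> ~ distributive_lattice L ->
  exists s a b c t : L, diamond s a b c t /\ s <> t.
Proof.
move=> modL ndis; apply: contrapT => nex; apply: ndis => x y z.
apply: contrapT => ne; apply: nex.
exists (lower_median x y z), (median_proj x y z), (median_proj y x z),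
  (median_proj z x y), (@lower_median (dual_lattice L) x y z).
split; first exact: median_diamond.
move=> e; apply: ne.
(* The dual of the lower median is the upper median. *)
have -> : x ⊓ (y ⊔ z) = x ⊓ @lower_median (dual_lattice L) x y z.
  by rewrite /lower_median /= !meet_assoc meet_joinK meet_joinK.
rewrite -e meet_comm /lower_median -modL; last by apply: latUx; apply: latIl.
apply: join_l; apply: lat_trans (latUr _ _); apply: latxI; first exact: latIr.
by apply: lat_trans (latIl _ _) (latIr _ _).
Qed.

Lemma diamond_lt (L : lattice) (s a b c t : L) :
  diamond s a b c t -> s <> t -> s ⊏ a /\ a ⊏ t.
Proof.
move=> [[ab ac bc] [ab1 ac1 bc1]] nst; split; split.
- by rewrite -ab; apply: latIl.
- move=> sa; apply: nst.
  have eb : b = t by rewrite -ab1 -sa join_r// -ab; apply: latIr.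
  have ec : c = t by rewrite -ac1 -sa join_r// -ac; apply: latIr.
  by rewrite -bc eb ec meet_idem.
- by rewrite -ab1; apply: latUl.
- move=> at_; apply: nst.
  have eb : b = s by rewrite -ab at_ meet_r// -ab1; apply: latUr.
  have ec : c = s by rewrite -ac at_ meet_r// -ac1; apply: latUr.
  by rewrite -bc1 eb ec join_idem.
Qed.

(** * Finite modular lattices *)

Lemma finite_seq_repeat (T : Type) (s : nat -> T) :
  finite_set [set: T] -> exists i j, i < j /\ s i = s j.
Proof.
move=> finT; apply: contrapT => nex; apply: infinite_nat.
rewrite -(preimage_setT s); apply: finite_preimage => // i j _ _ eij.
by case: (ltngtP i j) => // lij; case: nex; [exists i, j|exists j, i].
Qed.

Lemma finite_no_chain (T : Type) (r : T -> T -> Prop) (s : nat -> T) :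
  finite_set [set: T] -> (forall y x z, r x y -> r y z -> r x z) ->
  (forall x, ~ r x x) -> ~ (forall i, r (s i) (s i.+1)).
Proof.
move=> finT r_trans r_irr chain.
have [i [j [ij eij]]] := finite_seq_repeat s finT.
by have := homo_ltn r_trans chain ij; rewrite eij; apply: r_irr.
Qed.

Section ModularTransposition.
Variables (L : lattice) (modL : modular L).
Implicit Types a b s t z w : L.

Lemma transpose_downK a b t z : a ⊔ b = t -> a ⊑ z -> z ⊑ t -> a ⊔ (b ⊓ z) = z.
Proof. by move=> <- az zt; rewrite modL// meet_r. Qed.

Lemma transpose_upK a b s w : a ⊓ b = s -> s ⊑ w -> w ⊑ b -> (w ⊔ a) ⊓ b = w.
Proof. by move=> <- sw wb; rewrite -modL// join_l. Qed.

(** Modularity turns a diamond into isomorphisms between its sides.  The first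
    diamond takes [a, t] into [s, a] and the second one [s, a] into [a, y], so
    [a, t] injects into [a, y], which finiteness forbids for y below t unless
    y = t. *)
Lemma diamond_top_unique s a b c t b' c' y :
  finite_lattice L -> diamond s a b c t -> diamond s a b' c' y -> y ⊑ t -> y = t.
Proof.
move=> finL [[ab ac bc] [ab1 ac1 bc1]] [[ab' ac' bc'] [ab1' ac1' bc1']] yt.
have sa : s ⊑ a by rewrite -ab; apply: latIl.
have sb : s ⊑ b by rewrite -ab; apply: latIr.
have sb' : s ⊑ b' by rewrite -ab'; apply: latIr.
have ta : a ⊑ t by rewrite -ab1; apply: latUl.
have tb : b ⊑ t by rewrite -ab1; apply: latUr.
have tc : c ⊑ t by rewrite -ac1; apply: latUr.
have ya : a ⊑ y by rewrite -ab1'; apply: latUl.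
have yb' : b' ⊑ y by rewrite -ab1'; apply: latUr.
have yc' : c' ⊑ y by rewrite -ac1'; apply: latUr.
(* [down] goes from above a to below a through b and c, [up] goes back through
   c' and b'; [undown] and [unup] are their left inverses. *)
pose down z := a ⊓ (c ⊔ (b ⊓ z)); pose up w := a ⊔ (b' ⊓ (c' ⊔ w)).
pose undown w := a ⊔ (b ⊓ (c ⊔ w)); pose unup z := a ⊓ (c' ⊔ (b' ⊓ z)).
have downK z : a ⊑ z -> z ⊑ t -> undown (down z) = z.
  move=> az zt.
  rewrite /undown /down (@transpose_downK c a t) //; first last.
  - by apply: latUx => //; apply: lat_trans tb; apply: latIl.
  - exact: latUl.
  - by rewrite join_comm.
  rewrite [c ⊔ _]join_comm [b ⊓ (_ ⊔ _)]meet_comm (@transpose_upK _ _ s) //.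
  - exact: transpose_downK zt.
  - by rewrite meet_comm.
  - by apply: latxI => //; apply: lat_trans az.
  - exact: latIl.
have upK w : s ⊑ w -> w ⊑ a -> unup (up w) = w.
  move=> sw wa.
  have e : b' ⊓ up w = b' ⊓ (c' ⊔ w).
    rewrite /up meet_comm join_comm (@transpose_upK _ _ s) //.
    - by apply: latxI => //; apply: lat_trans sw (latUr _ _).
    - exact: latIl.
  rewrite /unup e (@transpose_downK c' b' y).
  - by rewrite join_comm meet_comm (@transpose_upK _ _ s) // meet_comm.
  - by rewrite join_comm.
  - exact: latUl.
  - by apply: latUx => //; apply: lat_trans ya.
have down_ge z : a ⊑ z -> s ⊑ down z.
  move=> az; apply: latxI => //; apply: lat_trans (latUr _ _).
  by apply: latxI => //; apply: lat_trans az.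
have up_le w : w ⊑ a -> up w ⊑ y.
  by move=> wa; apply: latUx => //; apply: lat_trans (latIl _ _) yb'.
(* The orbit of t repeats; as the map is injective, t itself recurs in it. *)
pose z_ n := iter n (up \o down) t.
have z_ge n : a ⊑ z_ n by case: n => //= n; apply: latUl.
have z_le n : z_ n.+1 ⊑ y by apply: up_le; apply: latIl.
have z_let n : z_ n ⊑ t by case: n => [|n]; [apply: latxx|apply: lat_trans yt].
have z_inj i j : z_ i.+1 = z_ j.+1 -> z_ i = z_ j.
  move=> /(congr1 (undown \o unup)) /=.
  rewrite !upK ?downK //; do ?exact: z_let; do ?exact: z_ge; try exact: latIl.
  - exact/down_ge/z_ge.
  - exact/down_ge/z_ge.
have [i [j [ij]]] := finite_seq_repeat z_ finL.
elim: i j ij => [|i IH] [|j] //; last by move=> ij /z_inj; apply: IH.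
by move=> _ e; apply: lat_anti => //; rewrite -[t]/(z_ 0) e.
Qed.
End ModularTransposition.

(** * Embeddings and varieties *)

Section HomTheory.
Variables (L M : lattice) (f : L -> M) (fH : lattice_hom f).

Lemma lattice_hom_meet x y : f (x ⊓ y) = f x ⊓ f y. Proof. exact: fH.1. Qed.
Lemma lattice_hom_join x y : f (x ⊔ y) = f x ⊔ f y. Proof. exact: fH.2. Qed.

End HomTheory.

Section EmbeddingTheory.
Variables (L M : lattice) (f : L -> M) (fE : lattice_embedding f).

Lemma lattice_embedding_lt x y : f x ⊏ f y <-> x ⊏ y.
Proof.
case: fE => finj fH; rewrite /lat_lt /lat_le -lattice_hom_meet //.
split=> -[e ne]; split; [exact: finj| by move=> exy; apply: ne; rewrite exy|by rewrite e|].
by move/finj.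
Qed.

Lemma lattice_embedding_le x y : f x ⊑ f y <-> x ⊑ y.
Proof.
by case: fE => finj fH; rewrite /lat_le -lattice_hom_meet //; split=> [/finj|->].
Qed.

Lemma lattice_embedding_diamond s a b c t :
  diamond (f s) (f a) (f b) (f c) (f t) <-> diamond s a b c t.
Proof.
case: fE => finj fH; rewrite /diamond -!lattice_hom_meet // -!lattice_hom_join //.
by split=> [[[/finj-> /finj-> /finj->] [/finj-> /finj-> /finj->]]|[[-> -> ->] [-> -> ->]]].
Qed.
End EmbeddingTheory.

Lemma sval_embedding (L : lattice) (S : set L) (subS : sub_universe S) :
  @lattice_embedding (sublattice subS) L sval.
Proof. by split; [apply: sub_sval_inj|split]. Qed.

Lemma proj_hom (I : Type) (F : I -> lattice) (i : I) :
  @lattice_hom (prod_lattice F) (F i) (fun x => x i).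
Proof. by []. Qed.

Lemma range_sub_universe (L M : lattice) (f : L -> M) :
  lattice_hom f -> sub_universe (range f).
Proof.
move=> fH; split; first by case: (lattice_inhabited L) => x; exists (f x), x.
- by move=> _ _ [x _ <-] [y _ <-]; exists (x ⊓ y) => //; apply: lattice_hom_meet.
- by move=> _ _ [x _ <-] [y _ <-]; exists (x ⊔ y) => //; apply: lattice_hom_join.
Qed.

Section Variety.
Variables (V : lattice -> Prop) (varV : variety V).

Lemma variety_embedding (L M : lattice) (f : L -> M) :
  lattice_embedding f -> V M -> V L.
Proof.
move=> [finj fH] VM; have subR := range_sub_universe fH.
have inv (y : sublattice subR) : {x | f x = sval y}.
  by have [x _ e] := cid2 (svalP y); exists x.
apply: (@variety_image _ varV _ _ (fun y => sval (inv y))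
  (variety_sub varV subR VM)).
  by split=> x y; apply: finj; rewrite ?(lattice_hom_meet fH) ?(lattice_hom_join fH);
    rewrite !(svalP (inv _)).
move=> x; have Rx : range f (f x) by exists x.
by exists (exist _ (f x) Rx); apply: finj; rewrite (svalP (inv _)).
Qed.

(** Finite configurations in a member of V can be moved to a finite member. *)
Lemma finite_generated_member (L : lattice) (G : set L) :
    locally_finite V -> V L -> finite_set G -> G !=set0 ->
  exists B : lattice, fin_members V B /\
    exists2 f : B -> L, lattice_embedding f & G `<=` range f.
Proof.
move=> lfV VL finG [g0 Gg0].
pose S := [set x | forall T : set L, sub_universe T -> G `<=` T -> T x].
have subS : sub_universe S.
  split; first by exists g0 => T _; apply.
  - move=> x y Sx Sy T subT GT; have [_ TI _] := subT.
    by apply: TI; [apply: Sx|apply: Sy].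
  - move=> x y Sx Sy T subT GT; have [_ _ TU] := subT.
    by apply: TU; [apply: Sx|apply: Sy].
have GS x : G x -> S x by move=> Gx T _; apply.
have VS := variety_sub varV subS VL.
have [sval_inj sval_hom] := sval_embedding subS.
exists (sublattice subS); split; last first.
  exists sval; first exact: sval_embedding.
  by move=> x Gx; exists (exist S x (GS x Gx)).
split=> //; apply: lfV => //.
exists (@sval L S @^-1` G); first by apply: finite_preimage => // x y _ _; apply: sval_inj.
move=> T subT GT; apply/seteqP; split=> // x _.
have subT' : sub_universe (@sval L S @` T).
  have [[t Tt] TI TU] := subT.
  split; first by exists (sval t), t.
  - by move=> _ _ [y Ty <-] [z Tz <-]; exists (@meet (sublattice subS) y z) => //; apply: TI.
  - by move=> _ _ [y Ty <-] [z Tz <-]; exists (@join (sublattice subS) y z) => //; apply: TU.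
have [|y Ty /sval_inj <- //] := svalP x _ subT'.
by move=> g Gg; exists (exist S g (GS g Gg)) => //; apply: GT.
Qed.
End Variety.

(** * Distributive lattices *)

Definition prime_ideal (L : lattice) (I : set L) : Prop :=
  [/\ forall x y, I x -> I y -> I (x ⊔ y),
      forall x y, x ⊑ y -> I y -> I x &
      forall x y, I (x ⊓ y) -> I x \/ I y].

(** Prime ideal theorem: a down-set closed under joins that is maximal among
    those containing y and avoiding x is prime, since x below k ⊔ p and k ⊔ q
    would be below k ⊔ (p ⊓ q). *)
Lemma prime_ideal_separation (L : lattice) (x y : L) :
    distributive_lattice L -> ~ x ⊑ y ->
  exists I : set L, [/\ prime_ideal I, I y & ~ I x].
Proof.
move=> dist nxy.
(* The empty set is allowed because it is the union of the empty chain. *)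
pose P (I : set L) := [/\ I = set0 \/ I y, ~ I x,
  forall u v, I u -> I v -> I (u ⊔ v) & forall u v, u ⊑ v -> I v -> I u].
have [F PF totF|I [[Iy nIx IU Ile] maxI]] := @Zorn_bigcup L P.
  split.
  - have [[I [FI Iy]]|nex] := pselect (exists I, F I /\ I y); first by right; exists I.
    left; apply/seteqP; split=> // u [I FI Iu]; case: nex; exists I; split=> //.
    by have [[I0|//] _ _ _] := PF _ FI; move: Iu; rewrite I0.
  - by move=> [I FI Ix]; have [_ + _ _] := PF _ FI; apply.
  - move=> u v [I FI Iu] [J FJ Jv]; have [IJ|JI] := totF _ _ FI FJ.
      by exists J => //; have [_ _ + _] := PF _ FJ; apply=> //; apply: IJ.
    by exists I => //; have [_ _ + _] := PF _ FI; apply=> //; apply: JI.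
  - move=> u v uv [I FI Iv]; exists I => //.
    by have [_ _ _] := PF _ FI; apply; eauto.
have {}Iy : I y.
  case: Iy => // I0; exfalso; apply: (maxI [set z | z ⊑ y]).
    rewrite I0; split=> // /(_ y); apply; exact: latxx.
  split=> //; first by right; apply: latxx.
    by move=> u v; apply: latUx.
  by move=> u v uv; apply: lat_trans.
exists I; split=> //; split=> // p q Ipq.
have key r : ~ I r -> exists2 k, I k & x ⊑ k ⊔ r.
  move=> nIr; apply: contrapT => nex.
  apply: (maxI [set z | exists2 k, I k & z ⊑ k ⊔ r]).
    split=> [z Iz|/(_ r)]; first by exists z => //; apply: latUl.
    by move=> h; apply: nIr; apply: h; exists y => //; apply: latUr.
  split=> //.
  - by right; exists y => //; apply: latUl.
  - move=> u v [k Ik uk] [l Il vl]; exists (k ⊔ l); first exact: IU.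
    apply: latUx; first by apply: lat_trans uk _; apply: latU2 (latUl _ _) (latxx _).
    by apply: lat_trans vl _; apply: latU2 (latUr _ _) (latxx _).
  - by move=> u v uv [k Ik vk]; exists k => //; apply: lat_trans vk.
apply: contrapT => /not_orP [/key [k Ik xk] /key [l Il xl]]; apply: nIx.
apply: (@Ile _ ((k ⊔ l) ⊔ (p ⊓ q))); last by apply: (IU) => //; apply: IU.
have xp : x ⊑ (k ⊔ l) ⊔ p.
  by apply: lat_trans xk _; apply: latU2 (latUl _ _) (latxx _).
have xq : x ⊑ (k ⊔ l) ⊔ q.
  by apply: lat_trans xl _; apply: latU2 (latUr _ _) (latxx _).
apply: lat_trans (latxI xp xq) _.
rewrite dist; apply: latUx; first by apply: lat_trans (latIr _ _) (latUl _ _).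
rewrite meet_comm dist; apply: latUx.
  by apply: lat_trans (latIr _ _) (latUl _ _).
by rewrite meet_comm; apply: latUr.
Qed.

(** Two comparable elements o < i of a nontrivial member serve as truth values:
    each prime ideal gives a homomorphism into {o, i}, and together these separate
    points. *)
Lemma distributive_in_variety (V : lattice -> Prop) (L : lattice) :
  variety V -> nontrivial V -> distributive_lattice L -> V L.
Proof.
move=> varV [M VM [x [y nxy]]] dist.
pose o := x ⊓ y; pose i := x ⊔ y.
have oi : o ⊑ i by apply: lat_trans (latIl _ _) (latUl _ _).
have noi : o <> i.
  move=> e; apply: nxy; transitivity o; apply: lat_anti; try exact: latIl; try exact: latIr.
    by rewrite e; apply: latUl.
  by rewrite e; apply: latUr.
pose F (I : {I : set L | prime_ideal I}) := M.
pose f (z : L) : prod_lattice F := fun I => if `[< sval I z >] then o else i.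
apply: (@variety_embedding _ varV _ _ f); last exact: variety_prod.
split.
  have sep u v : f u = f v -> u ⊑ v.
    move=> e; apply: contrapT => /(prime_ideal_separation dist) [I [pI Iv nIu]].
    have := congr1 (@^~ (exist _ I pI)) e; rewrite /f /=.
    by rewrite (asboolF nIu) (asboolT Iv) => /esym.
  by move=> u v e; apply: lat_anti; apply: sep.
split=> u v; apply: functional_extensionality_dep => -[I pI].
  rewrite /= /prod_meet /f /=; have [_ Ile Ipr] := pI.
  case: asboolP => [/Ipr|nIuv].
    case: asboolP => [_ _|nIu [//|Iv]]; first by case: ifP => _; rewrite ?meet_idem// meet_l.
    by rewrite (asboolT Iv) meet_r.
  have nIu : ~ I u by move=> Iu; apply: nIuv; apply: Ile Iu; apply: latIl.
  have nIv : ~ I v by move=> Iv; apply: nIuv; apply: Ile Iv; apply: latIr.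
  by rewrite (asboolF nIu) (asboolF nIv) meet_idem.
rewrite /= /prod_join /f /=; have [IU Ile _] := pI.
case: asboolP => [Iuv|nIuv].
  have Iu : I u by apply: Ile Iuv; apply: latUl.
  have Iv : I v by apply: Ile Iuv; apply: latUr.
  by rewrite (asboolT Iu) (asboolT Iv) join_idem.
case: asboolP => [Iu|_]; last by case: ifP => _; rewrite ?join_idem// join_l.
by rewrite asboolF ?join_r// => Iv; apply: nIuv; apply: IU.
Qed.

(** * Amalgamation from the Ramsey property *)

Definition amalgamation (K : lattice -> Prop) : Prop :=
  forall (A B C : lattice) (f : A -> B) (g : A -> C), K A -> K B -> K C ->
  lattice_embedding f -> lattice_embedding g ->
  exists2 D, K D & exists (h : B -> D) (k : C -> D),
    [/\ lattice_embedding h, lattice_embedding k & forall x, h (f x) = k (g x)].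

Lemma lattice_hom_comp (L M N : lattice) (f : M -> N) (g : L -> M) :
  lattice_hom f -> lattice_hom g -> lattice_hom (f \o g).
Proof.
by move=> fH gH; split=> x y /=;
  rewrite ?(lattice_hom_meet gH) ?(lattice_hom_join gH) ?(lattice_hom_meet fH)
    ?(lattice_hom_join fH).
Qed.

Lemma ordered_embedding_comp (A B C : ordered_lattice) (f : B -> C) (g : A -> B) :
  ordered_embedding f -> ordered_embedding g -> ordered_embedding (f \o g).
Proof.
move=> [[finj fH] fo] [[ginj gH] go]; split; last by move=> x y /=; rewrite fo go.
by split; [apply: inj_comp|apply: lattice_hom_comp].
Qed.

(** Comparing f and g gives a strictly increasing self-map of A, and on a finite
    linear order only the identity is one. *)
Lemma ordered_embedding_rigid (A C : ordered_lattice) (f g : A -> C) :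
  finite_lattice A -> ordered_embedding f -> ordered_embedding g ->
  range f `<=` range g -> f =1 g.
Proof.
move=> finA [_ fo] [_ go] fg.
have lift x : {y | g y = f x}.
  by have [y _ e] := cid2 (fg (f x) (ex_intro2 _ _ x I erefl)); exists y.
pose s x := sval (lift x); have gs x : g (s x) = f x := svalP (lift x).
have so x y : olt (s x) (s y) = olt x y by rewrite -go !gs fo.
have [irr tr tot] := olt_linear A.
suff sid x : s x = x by move=> x; rewrite -gs sid.
apply: contrapT => ne; have /orP[lt|lt] := tot _ _ ne.
- apply: (@finite_no_chain _ (fun y z => olt z y) (fun n => iter n s x) finA).
  + by move=> y z w zy yw; apply: tr yw zy.
  + by move=> y; rewrite irr.
  + by elim=> //= n; rewrite so.
- apply: (@finite_no_chain _ (fun y z => olt y z) (fun n => iter n s x) finA).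
  + by move=> y z w; apply: tr.
  + by move=> y; rewrite irr.
  + by elim=> //= n; rewrite so.
Qed.

Lemma copiesP (B A : ordered_lattice) (S : set B) :
  copies B A S <-> exists2 f : A -> B, ordered_embedding f & range f = S.
Proof.
split.
  move=> [subS [f fE [g fK gK]]].
  have [[finj fH] fo] := fE.
  exists (fun x => sval (g x)).
    split; last by move=> x y; rewrite -[x in RHS]gK -[y in RHS]gK fo.
    split; first by move=> x y /sub_sval_inj/(can_inj gK).
    split=> x y.
      rewrite -{1}[x]gK -{1}[y]gK -(lattice_hom_meet fH) fK //.
    by rewrite -{1}[x]gK -{1}[y]gK -(lattice_hom_join fH) fK.
  apply/seteqP; split=> [_ [x _ <-]|x Sx]; first exact: svalP.
  by exists (f (exist S x Sx)) => //; rewrite fK.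
move=> [f fE <-]; have [[finj fH] fo] := fE.
have subR := range_sub_universe fH; exists subR.
have inv (y : sublattice subR) : {x | f x = sval y}.
  by have [x _ e] := cid2 (svalP y); exists x.
have fi y : f (sval (inv y)) = sval y := svalP (inv y).
have Rf x : range f (f x) by exists x.
exists (fun y => sval (inv y)); last first.
  exists (fun x => exist _ (f x) (Rf x)).
    by move=> y; apply: sub_sval_inj; rewrite /= fi.
  by move=> x; apply: finj; rewrite fi.
split; last by move=> x y; rewrite -fo !fi.
split; first by move=> x y /(congr1 f); rewrite !fi => /sub_sval_inj.
split=> x y; apply: finj.
  by rewrite (lattice_hom_meet fH) !fi.
by rewrite (lattice_hom_join fH) !fi.
Qed.

(** Two colours suffice: a copy of A in C is red if some embedding of B1 in C
    maps f1(A) onto it. *)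
Lemma Ramsey_amalgamation (Ks : ordered_lattice -> Prop)
    (A B1 B2 : ordered_lattice) (f1 : A -> B1) (f2 : A -> B2) :
  Ramsey Ks -> joint_embedding Ks -> finite_lattice A ->
  Ks A -> Ks B1 -> Ks B2 -> ordered_embedding f1 -> ordered_embedding f2 ->
  exists2 C, Ks C & exists (h1 : B1 -> C) (h2 : B2 -> C),
    [/\ ordered_embedding h1, ordered_embedding h2 & forall x, h1 (f1 x) = h2 (f2 x)].
Proof.
move=> ramK jep finA KA KB1 KB2 f1E f2E.
have [E KE [[g1 g1E] [g2 g2E]]] := jep _ _ KB1 KB2.
have AE : embeds A E by exists (g1 \o f1); apply: ordered_embedding_comp.
have [C KC arrC] := ramK _ _ KA KE AE 2 isT; exists C => //.
pose red (T : set C) := exists2 h : B1 -> C, ordered_embedding h & range (h \o f1) = T.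
pose X (j : 'I_2) := [set T | copies C A T /\ (red T <-> nat_of_ord j = 0)].
have [||S /copiesP [e eE eS] [j monoX]] := arrC X.
- apply/trivIsetP => i j _ _ nij; apply/seteqP; split=> // T [[_ ri] [_ rj]].
  have {ri rj} ij0 : nat_of_ord i = 0 <-> nat_of_ord j = 0 by rewrite -ri -rj.
  case/eqP: nij; apply/val_inj.
  by case: i j ij0 => [[|[|//]] ?] [[|[|//]] ?] //= [] => [/(_ erefl)|_ /(_ erefl)].
- apply/seteqP; split=> [T [j _ []]//|T cT].
  have [rT|nrT] := pselect (red T); first by exists ord0.
  by exists ord_max => //; split=> //; split.
have copy (f : A -> E) : ordered_embedding f -> X j (range (e \o f)).
  move=> fE; apply: monoX; last by move=> _ [x _ <-]; rewrite -eS; exists (f x).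
  by apply/copiesP; exists (e \o f) => //; apply: ordered_embedding_comp.
have [_ red1] := copy _ (ordered_embedding_comp g1E f1E).
have [_ red2] := copy _ (ordered_embedding_comp g2E f2E).
have /red2 [h hE hR] : nat_of_ord j = 0.
  by apply/red1; exists (e \o g1) => //; apply: ordered_embedding_comp.
exists h, (e \o g2); split=> //; first exact: ordered_embedding_comp.
apply: (ordered_embedding_rigid finA); [exact: ordered_embedding_comp| |].
  by apply: ordered_embedding_comp => //; apply: ordered_embedding_comp.
by rewrite hR.
Qed.

Lemma Ramsey_expansion_amalgamation (V : lattice -> Prop)
    (Ks : ordered_lattice -> Prop) :
  reasonable_JEP_expansion (fin_members V) Ks -> Ramsey Ks ->
  amalgamation (fin_members V).
Proof.
move=> [[KsV expand] reas jep] ram A B C f g KA KB KC fE gE.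
have [r [hr Kr]] := expand A KA.
have [s [hs [Ksr fE']]] := reas _ _ f KA KB fE r hr Kr.
have [t [ht [Kt gE']]] := reas _ _ g KA KC gE r hr Kr.
have [D KD [h [k [[hE _] [kE _] hk]]]] :=
  Ramsey_amalgamation ram jep (KA.2 : finite_lattice (OrderedLattice hr)) Kr Ksr Kt fE' gE'.
by exists D; [apply: KsV|exists h, k].
Qed.

(** * Amalgamation over a three-element chain *)

Definition chain_lattice (n : nat) : lattice :=
  @Lattice 'I_n.+1 Order.min Order.max (inhabits ord0)
    (@minxx _ _) (@maxxx _ _) (@minC _ _) (@maxC _ _) (@minA _ _) (@maxA _ _)
    (@maxKx _ _) (@minKx _ _).

Lemma chain_embedding (n : nat) (L : lattice) (e : 'I_n.+1 -> L) :
  (forall i j : 'I_n.+1, i < j -> e i ⊏ e j) ->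
  @lattice_embedding (chain_lattice n) L e.
Proof.
move=> e_lt.
have e_le (i j : 'I_n.+1) : (i <= j)%O -> e i ⊑ e j.
  rewrite leEord leq_eqVlt => /orP[/eqP/val_inj ->|/e_lt[]//]; exact: latxx.
split.
  move=> i j eij; apply/val_inj; case: (ltngtP i j) => // /e_lt [_] //.
  by rewrite eij.
split=> i j; rewrite /=; case: leP => [/e_le|/ltW/e_le] le.
- by rewrite meet_l.
- by rewrite meet_r.
- by rewrite join_r.
- by rewrite join_l.
Qed.

(** Any two three-element chains are isomorphic sublattices, whatever lattices
    they lie in, so they can always be identified. *)
Lemma amalgamate_chains (V : lattice -> Prop) (B C : lattice)
    (x y z : B) (x' y' z' : C) :
  variety V -> amalgamation (fin_members V) -> fin_members V B -> fin_members V C ->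
  x ⊏ y -> y ⊏ z -> x' ⊏ y' -> y' ⊏ z' ->
  exists2 D, fin_members V D & exists (h : B -> D) (k : C -> D),
    [/\ lattice_embedding h, lattice_embedding k & [/\ h x = k x', h y = k y' & h z = k z']].
Proof.
move=> varV ap KB KC xy yz xy' yz'.
have emb (L : lattice) (u v w : L) : u ⊏ v -> v ⊏ w ->
    @lattice_embedding (chain_lattice 2) L (nth u [:: u; v; w]).
  move=> uv vw; apply: chain_embedding.
  case=> [[|[|[|//]]] ?] [[|[|[|//]]] ?] //= _; exact: lat_lt_trans vw.
have fE := emb _ _ _ _ xy yz; have gE := emb _ _ _ _ xy' yz'.
have K3 : fin_members V (chain_lattice 2).
  by split; [apply: variety_embedding fE KB.1|apply: finite_finset].
have [D KD [h [k [hE kE hk]]]] := ap _ _ _ _ _ K3 KB KC fE gE.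
exists D => //; exists h, k; split=> //; split.
- exact: (hk ord0).
- exact: (hk (@Ordinal 3 1 isT)).
- exact: (hk ord_max).
Qed.

(** * Nonmodular lattices *)

(** The sequence e_0 = p, e_1 = q, e_(i+2) = e_i v (e_(i+1) ^ m).  Recursing on
    the pair (e_0, e_1) makes prepending a term to the sequence a computation. *)
Fixpoint zigzag (L : lattice) (p q m : L) (n : nat) : L :=
  if n is n'.+1 then zigzag q (p ⊔ (q ⊓ m)) m n' else p.

Lemma zigzag_hom (L M : lattice) (f : L -> M) (p q m : L) (n : nat) :
  lattice_hom f -> f (zigzag p q m n) = zigzag (f p) (f q) (f m) n.
Proof.
move=> fH; elim: n p q => //= n IH p q.
by rewrite IH (lattice_hom_join fH) (lattice_hom_meet fH).
Qed.

Definition zigzag_trace (L : lattice) (p q m : L) (n : nat) : L :=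
  zigzag p q m n ⊓ m.

Lemma zigzag_trace_hom (L M : lattice) (f : L -> M) (p q m : L) (n : nat) :
  lattice_hom f -> f (zigzag_trace p q m n) = zigzag_trace (f p) (f q) (f m) n.
Proof. by move=> fH; rewrite (lattice_hom_meet fH) zigzag_hom. Qed.

Section AmalgamationForcesDistributivity.
Variables (V : lattice -> Prop) (varV : variety V) (lfV : locally_finite V).

Lemma finite_pentagon (L : lattice) : V L -> ~ modular L ->
  exists2 B : lattice, fin_members V B & exists a c b t : B,
    [/\ a ⊏ c, c ⊏ t, b ⊔ a = t & b ⊓ c ⊏ a].
Proof.
move=> VL /not_modularP [a' [c' [b' [t' [ac' ct' ba' bc']]]]].
have [||B [KB [f fE fG]]] :=
    @finite_generated_member _ varV L [set a'; c'; b'] lfV VL.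
- by rewrite !finite_setU; do ?split; apply: finite_set1.
- by exists a'; left; left.
have [a _ ea] : range f a' by apply: fG; left; left.
have [c _ ec] : range f c' by apply: fG; left; right.
have [b _ eb] : range f b' by apply: fG; right.
exists B => //; exists a, c, b, (b ⊔ a); have [_ fH] := fE.
split=> //; rewrite -(lattice_embedding_lt fE) ?(lattice_hom_join fH)
  ?(lattice_hom_meet fH) ea ?eb ?ec //; by rewrite ba'.
Qed.

(** Each step prepends one term by amalgamating with a pentagon along
    v_0 < v_1 < e_1.  The conditions that e_0, e_1 are not below m keep this a
    three-element chain at the next step. *)
Lemma long_zigzag (n : nat) (L : lattice) :
  amalgamation (fin_members V) -> V L -> ~ modular L ->
  exists2 D : lattice, fin_members V D & exists p q m : D,
    [/\ ~ p ⊑ m, ~ q ⊑ m &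
        forall i, i <= n -> zigzag_trace p q m i ⊏ zigzag_trace p q m i.+1].
Proof.
move=> ap VL /(finite_pentagon VL) [B KB [a [c [b [t [ac ct ba bc]]]]]].
have nct : ~ t ⊑ c by move=> tc; apply: ct.2; apply: lat_anti tc; exact: ct.1.
have nbc : ~ b ⊑ c.
  by move=> /latUx/(_ ac.1); rewrite ba.
elim: n => [|n [C KC [p [q [m [npm nqm trace_lt]]]]]].
  exists B => //; exists b, t, c; split=> // -[|//] _.
  rewrite /zigzag_trace /= [t ⊓ c]meet_r; last exact: ct.1.
  exact: lat_lt_trans bc ac.
have qm_q : q ⊓ m ⊏ q.
  by split; [apply: latIl|move=> e; apply: nqm; rewrite -e; apply: latIr].
have [D KD [h [k [hE kE [ea ec et]]]]] :=
  amalgamate_chains varV ap KB KC ac ct (trace_lt 0 isT) qm_q.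
rewrite /zigzag_trace /= in ea ec et.
exists D => //; exists (h b), (k p), (k m).
have [[_ hH] [_ kH]] := (hE, kE).
(* The new sequence is b, e_0, e_1, ...: its third term is the old e_1. *)
have next : h b ⊔ (k p ⊓ k m) = k q.
  by rewrite -(lattice_hom_meet kH) -ea -(lattice_hom_join hH) ba et.
have hbm : h b ⊓ k m = h (b ⊓ c).
  rewrite (lattice_hom_meet hH) ec (lattice_hom_meet kH) -et meet_assoc.
  by rewrite -(lattice_hom_meet hH) [b ⊓ t]meet_l// -ba; apply: latUl.
split.
- move=> bm; apply: nqm; rewrite -(lattice_embedding_le kE) -next.
  by apply: latUx => //; apply: latIr.
- by rewrite (lattice_embedding_le kE).
case=> [_|i /trace_lt]; rewrite /zigzag_trace /=.
  by rewrite hbm -(lattice_hom_meet kH) -ea (lattice_embedding_lt hE).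
rewrite next -/(zigzag_trace (k p) (k q) (k m) i).
rewrite -/(zigzag_trace (k p) (k q) (k m) i.+1).
by rewrite -!(zigzag_trace_hom _ _ _ _ kH) (lattice_embedding_lt kE).
Qed.

(** In the product of zigzags of all lengths the traces are pairwise distinct,
    as the j-th coordinate separates v_i from v_j for i < j, although three
    elements generate them all. *)
Lemma amalgamation_modular (L : lattice) :
  amalgamation (fin_members V) -> V L -> modular L.
Proof.
move=> ap VL; apply: contrapT => nmod.
pose ok n (x : {D : lattice & (D * D * D)%type}) :=
  let: existT D (p, q, m) := x in fin_members V D /\
    forall i, i <= n -> zigzag_trace p q m i ⊏ zigzag_trace p q m i.+1.
have ex n : {x | ok n x}.
  apply: cid; have [D KD [p [q [m [_ _ lt]]]]] := long_zigzag n ap VL nmod.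
  by exists (existT _ D (p, q, m)).
pose F n := tag (sval (ex n)).
pose p : prod_lattice F := fun n => (tagged (sval (ex n))).1.1.
pose q : prod_lattice F := fun n => (tagged (sval (ex n))).1.2.
pose m : prod_lattice F := fun n => (tagged (sval (ex n))).2.
have F_ok n : fin_members V (F n) /\
    forall i, i <= n -> zigzag_trace (p n) (q n) (m n) i ⊏ zigzag_trace (p n) (q n) (m n) i.+1.
  rewrite /F /p /q /m; move: (svalP (ex n)).
  by case: (sval (ex n)) => D [[p' q'] m'].
have VF : V (prod_lattice F) by apply: variety_prod => // n; have [[]] := F_ok n.
have [||B [[_ finB] [f [_ fH] fG]]] :=
    @finite_generated_member _ varV _ [set p; q; m] lfV VF.
- by rewrite !finite_setU; do ?split; apply: finite_set1.
- by exists p; left; left.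
have [p' _ ep] : range f p by apply: fG; left; left.
have [q' _ e_q] : range f q by apply: fG; left; right.
have [m' _ em] : range f m by apply: fG; right.
have [i [j [ij e]]] := finite_seq_repeat (zigzag_trace p' q' m') finB.
have {}e : zigzag_trace (p j) (q j) (m j) i = zigzag_trace (p j) (q j) (m j) j.
  have := congr1 (fun x => f x j) e.
  by rewrite !(zigzag_trace_hom _ _ _ _ fH) ep e_q em
    !(zigzag_trace_hom _ _ _ _ (@proj_hom _ F j)).
have [_ trace_lt] := F_ok j.
suff [] : zigzag_trace (p j) (q j) (m j) i ⊏ zigzag_trace (p j) (q j) (m j) j by [].
have conv : {in [pred k | k <= j] &, forall i l k, i < k < l -> k \in [pred k | k <= j]}.
  by move=> k l _ lj r /andP[_ rl]; apply: leq_trans (ltnW rl) lj.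
have step : {in [pred k | k <= j], forall k, k.+1 \in [pred k | k <= j] ->
    zigzag_trace (p j) (q j) (m j) k ⊏ zigzag_trace (p j) (q j) (m j) k.+1}.
  by move=> k kj _; apply: trace_lt.
by apply: (homo_ltn_in (@lat_lt_trans (F j)) conv step); rewrite ?inE // ltnW.
Qed.

(** * Modular lattices *)

(** Identify s < a < t with (s, s) < (a, s) < (t, t) in B x B.  The second chain
    leaves room for the diamond with top (t, s) between (a, s) and (t, t). *)
Lemma amalgamation_distributive (L : lattice) :
  amalgamation (fin_members V) -> V L -> distributive_lattice L.
Proof.
move=> ap VL; apply: contrapT => ndis.
have [s0 [a0 [b0 [c0 [t0 [dia0 nst0]]]]]] :=
  not_distributive_diamond (amalgamation_modular ap VL) ndis.
have [||B [KB [f fE fG]]] :=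
    @finite_generated_member _ varV L [set s0; a0; b0; c0; t0] lfV VL.
- by rewrite !finite_setU; do ?split; apply: finite_set1.
- by exists t0; right.
have [s _ es] : range f s0 by apply: fG; do 4 left.
have [a _ ea] : range f a0 by apply: fG; do 3 left; right.
have [b _ eb] : range f b0 by apply: fG; do 2 left; right.
have [c _ ec] : range f c0 by apply: fG; left; right.
have [t _ et] : range f t0 by apply: fG; right.
have dia : diamond s a b c t.
  by apply/(lattice_embedding_diamond fE); rewrite es ea eb ec et.
have nst : s <> t by move=> e; apply: nst0; rewrite -es -et e.
have [sa at_] := diamond_lt dia nst.
pose P := prod_lattice (fun _ : bool => B).
have VP : V P by apply: variety_prod => // _; exact: KB.1.
pose pair (u v : B) : P := fun i => if i then u else v.
have [||C [KC [g gE gG]]] := @finite_generated_member _ varV P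
  [set pair s s; pair a s; pair b s; pair c s; pair t s; pair t t] lfV VP.
- by rewrite !finite_setU; do ?split; apply: finite_set1.
- by exists (pair t t); right.
have [ss _ ess] : range g (pair s s) by apply: gG; do 5 left.
have [as_ _ eas] : range g (pair a s) by apply: gG; do 4 left; right.
have [bs _ ebs] : range g (pair b s) by apply: gG; do 3 left; right.
have [cs _ ecs] : range g (pair c s) by apply: gG; do 2 left; right.
have [ts _ ets] : range g (pair t s) by apply: gG; left; right.
have [tt_ _ ett] : range g (pair t t) by apply: gG; right.
have pair_le u v u' v' : u ⊑ u' -> v ⊑ v' -> pair u v ⊑ pair u' v'.
  by move=> uu' vv'; apply: functional_extensionality_dep => -[].
have st : s ⊑ t by apply: lat_trans sa.1 at_.1.
have ss_as : ss ⊏ as_.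
  rewrite -(lattice_embedding_lt gE) ess eas.
  split; first by apply: pair_le (latxx _); exact: sa.1.
  by move=> /(congr1 (@^~ true)); exact: sa.2.
have as_tt : as_ ⊏ tt_.
  rewrite -(lattice_embedding_lt gE) eas ett.
  split; first by apply: pair_le => //; exact: at_.1.
  by move=> /(congr1 (@^~ true)); exact: at_.2.
have dia' : diamond ss as_ bs cs ts.
  apply/(lattice_embedding_diamond gE); rewrite ess eas ebs ecs ets.
  case: dia => -[? ? ?] [? ? ?].
  by split; split; apply: functional_extensionality_dep => -[];
    rewrite /= /prod_meet /prod_join /pair ?meet_idem ?join_idem.
have [D [VD finD] [h [k [hE kE [hs ha ht]]]]] :=
  amalgamate_chains varV ap KB KC sa at_ ss_as as_tt.
have ts_tt : ts ⊑ tt_.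
  by rewrite -(lattice_embedding_le gE) ets ett; apply: pair_le => //; apply: latxx.
have diaD := (lattice_embedding_diamond hE _ _ _ _ _).2 dia.
have diaD' := (lattice_embedding_diamond kE _ _ _ _ _).2 dia'.
have kts : k ts ⊑ h t by rewrite ht; apply/(lattice_embedding_le kE).
rewrite -hs -ha in diaD'.
have := diamond_top_unique (amalgamation_modular ap VD) finD diaD diaD' kts.
rewrite ht => /kE.1 e; apply: nst.
by have := congr1 (fun x => g x false) e; rewrite ets ett.
Qed.
End AmalgamationForcesDistributivity.

Theorem theorem3p1 (V : lattice -> Prop) (Ks : ordered_lattice -> Prop) :
  variety V -> nontrivial V -> locally_finite V ->
  ~ (forall L : lattice, V L) ->
  ~ (forall L : lattice, V L <-> distributive_lattice L) ->
  reasonable_JEP_expansion (fin_members V) Ks ->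
  ~ Ramsey Ks.
Proof.
move=> varV ntV lfV _ nD expK ram; apply: nD => L.
have ap := Ramsey_expansion_amalgamation expK ram.
split; first exact: amalgamation_distributive ap.
exact: distributive_in_variety.
Qed.
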